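(* (In $\mathsf{ZFC}$.) There is a $\trianglelefteq$-antichain of $\aleph_1$-dense Countryman lines of size $\aleph_1$; that is, there is a family of $\aleph_1$ many $\aleph_1$-dense Countryman lines such that for any two distinct members $A,B$ of the family neither $A\trianglelefteq B$ nor $B\trianglelefteq A$.
   Context: $A\trianglelefteq B$ means that $A=\varnothing$ or there is an epimorphism from $B$ onto $A$, i.e. a surjective monotone map $f:B\to A$ ($x\le y$ implies $f(x)\le f(y)$). A Countryman line is an uncountable linear order $C$ such that $C^2$, with the coordinatewise product order, is a union of countably many chains. A nonempty linear order $A$ is $\aleph_1$-dense if it has no left or right endpoint and $[a,b]_A$ has size $\aleph_1$ for all $a<_A b$. *)

(* Defs.v *)
From HB Require Import structures.
From mathcomp Require Import all_boot all_order.
From mathcomp Require Import boolp wochoice classical_sets functions cardinality.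

Set Implicit Arguments.
Unset Strict Implicit.
Unset Printing Implicit Defensive.

Import Order.TTheory.

Local Open Scope classical_set_scope.
Local Open Scope order_scope.

(* [A] is in bijection with omega_1, the bijection being used to transport the
   order of omega_1 to [A]: [R] is a (reflexive) well-order of [A], [A] is
   uncountable, and every proper initial segment of [A] for [R] is countable. *)
Definition size_aleph1 (T : Type) (A : set T) : Prop :=
  exists R : rel T,
    [/\ wo_chain R [in A],
        ~ countable A &
        forall a, A a -> countable [set b | [/\ A b, R b a & b <> a]]].

Definition epi_below (d d' : Order.disp_t)
    (A : orderType d) (B : orderType d') : Prop :=
  [set: A] = set0 \/
  exists f : B -> A,
    {homo f : x y / x <= y} /\ set_surj [set: B] [set: A] f.

(* [C *p C] is [C * C] with the coordinatewise order. *)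
Definition countryman (d : Order.disp_t) (C : orderType d) : Prop :=
  ~ countable [set: C] /\
  exists K : nat -> set (C *p C),
    (forall n, total_on (K n) (fun x y : C *p C => x <= y)) /\
    \bigcup_n K n = setT.

Definition aleph1_dense (d : Order.disp_t) (A : orderType d) : Prop :=
  [/\ [set: A] !=set0,
      ~ (exists a : A, forall x : A, a <= x),
      ~ (exists b : A, forall x : A, x <= b) &
      forall a b : A, a < b -> size_aleph1 [set x : A | a <= x <= b]].

(* Main.v *)
Require Import Defs.
From HB Require Import structures.
From mathcomp Require Import all_boot all_order ssralg ssrnum archimedean rat.
From mathcomp Require Import boolp wochoice classical_sets functions cardinality.

Set Implicit Arguments.
Unset Strict Implicit.
Unset Printing Implicit Defensive.

Import Order.TTheory GRing.Theory Num.Theory.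

Local Open Scope order_scope.
Local Open Scope classical_set_scope.

(** The family consists of lexicographically ordered sets of functions from
    omega_1 to the rationals, one for each member of a disjoint family of
    aleph_1 stationary subsets of omega_1.

    Walking along countable ordinals gives finite-to-one maps
    [walk b : {z | z < b} -> nat] that are coherent: any two of them differ at
    only finitely many common arguments.  Fix a set [S] of countable ordinals.
    A point of [line d S] is a function [t] with a height [b]: it is nonzero
    below [b], zero from [b] on, positive at the arguments below [b] that lie
    in [S], and differs from [walk b] (plus one) at finitely many places below
    [b].  The value 0 thus marks the end of [t], and in the order it sits at the
    bottom of the permitted values at coordinates in [S], but strictly inside
    them at the other coordinates.

    Every such line is Countryman ([countryman_line]), by Todorcevic's argument:
    for a pair of points of heights [a <= b], record a bound [n] on the values
    at the finitely many places up to [a] where the two disagree, and the list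
    of pairs of values at the places where they are at most [n].  There are
    countably many such records, and pairs with the same record form a chain
    ([profile_mono]).  The line is aleph_1-dense ([aleph1_dense_line]) because
    between two values at their first difference there is always a permitted
    rational, after which the function may be continued to any height.

    The set [S] can be read off from the line up to a nonstationary set, in the
    direction needed here ([no_epi]).  Let [f] be an epimorphism from the line
    of [T] onto that of [S], and let [z] be in [T] but not in [S], and closed
    under the countably many tasks posed by [f]: [f] maps the points of height
    below [z] onto the points of height below [z].  Call two points equivalent
    if they agree below [z].  In the line of [T] the class of a point of height
    at least [z] has a least element, its truncation at [z] ([node_least]); the
    map [f] sends this to a least element of a class in the line of [S],
    whereas such a class has no least element since [z] is not in [S]
    ([line_lower]).  Hence [T] minus [S] is nonstationary.  So it is enough to
    have aleph_1 pairwise disjoint stationary sets, and those come from an Ulam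
    matrix ([ulam_stationary]). *)

(** * The first uncountable ordinal *)

Definition cantor_wo : rel (nat -> bool) :=
  sval (well_ordering_principle (nat -> bool)).

Lemma cantor_woP : well_order cantor_wo.
Proof. exact: (svalP (well_ordering_principle _)). Qed.

Lemma cantor_wo_chain : wo_chain cantor_wo predT.
Proof. by move=> A _; apply: cantor_woP. Qed.

Lemma cantor_wo_refl : reflexive cantor_wo.
Proof. by move=> x; apply: (wo_chain_reflexive cantor_wo_chain). Qed.

Lemma cantor_wo_anti : antisymmetric cantor_wo.
Proof. by move=> x y; apply: (wo_chain_antisymmetric cantor_wo_chain). Qed.

Lemma cantor_wo_total : total cantor_wo.
Proof. by move=> x y; apply: (wo_chainW cantor_wo_chain). Qed.

Lemma cantor_wo_trans : transitive cantor_wo.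
Proof.
move=> y x z xy yz.
have [|m [[mA mlb] _]] := cantor_woP (A := [mem [:: x; y; z]]).
  by exists x; rewrite !inE eqxx.
have [mx [my mz]] : cantor_wo m x /\ cantor_wo m y /\ cantor_wo m z.
  by split; [|split]; apply: mlb; rewrite !inE eqxx ?orbT.
move: mA; rewrite !inE => /or3P[] /eqP E; rewrite E in mx my mz.
- exact: mz.
- by rewrite (cantor_wo_anti (x := x) (y := y)) // xy mx.
- by rewrite -(cantor_wo_anti (x := y) (y := z)) // yz my.
Qed.

(** The points with countably many predecessors form an initial segment of the
    well-ordered Cantor space, and it is the shortest uncountable one. *)
Definition omega1 : Type :=
  {x : nat -> bool | `[< countable [set y | cantor_wo y x /\ y <> x] >]}.

HB.instance Definition _ := Choice.on omega1.

Definition omega1_le (a b : omega1) := cantor_wo (val a) (val b).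

Lemma omega1_le_refl : reflexive omega1_le.
Proof. by move=> a; apply: cantor_wo_refl. Qed.

Lemma omega1_le_anti : antisymmetric omega1_le.
Proof. by move=> a b /cantor_wo_anti /val_inj. Qed.

Lemma omega1_le_trans : transitive omega1_le.
Proof. by move=> b a c; apply: cantor_wo_trans. Qed.

Lemma omega1_le_total : total omega1_le.
Proof. by move=> a b; apply: cantor_wo_total. Qed.

Fact omega1_display : Order.disp_t. Proof. exact: Order.Disp tt tt. Qed.

HB.instance Definition _ := Order.Le_isPOrder.Build omega1_display omega1
  omega1_le_refl omega1_le_anti omega1_le_trans.
HB.instance Definition _ :=
  Order.POrder_isTotal.Build omega1_display omega1 omega1_le_total.

Lemma omega1_min (P : set omega1) :
  P !=set0 -> exists2 m, P m & forall a, P a -> m <= a.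
Proof.
move=> [a Pa].
have [|z [[zP zlb] _]] := cantor_woP (A := [pred x | `[< (val @` P) x >]]).
  by exists (val a); rewrite inE; exists a.
move: zP; rewrite inE => -[m Pm mz]; exists m => // b Pb.
rewrite -mz in zlb.
by apply: (zlb (val b)); rewrite inE; exists b.
Qed.

Lemma countable_preimage_inj (T U : Type) (f : T -> U) (A : set T) (B : set U) :
  (forall x y, A x -> A y -> f x = f y -> x = y) ->
  (forall x, A x -> B (f x)) -> countable B -> countable A.
Proof.
move=> finj fAB /countable_injP [g ginj].
apply/countable_injP; exists (g \o f) => x y /set_mem xA /set_mem yA /= E.
by apply: finj => //; apply: ginj E; rewrite inE; apply: fAB.
Qed.

Lemma countable_sub (T : Type) (A : set T) :
  countable [set: {x | `[< A x >]}] -> countable A.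
Proof.
move=> ctbl.
have -> : A = (fun x : {x | `[< A x >]} => val x) @` setT.
  apply/seteqP; split=> [x Ax|_ [x _ <-]]; last exact/asboolP/(valP x).
  by exists (exist _ x (asboolT Ax)).
exact: sub_countable (card_image_le _ _) ctbl.
Qed.

Lemma countable_below (a : omega1) : countable [set b | b < a].
Proof.
have := svalP a => /asboolP.
apply: (countable_preimage_inj (f := val)).
  by move=> x y _ _ /val_inj.
move=> b /= ba; split; first exact: (ltW ba).
by move=> /val_inj E; move: ba; rewrite E ltxx.
Qed.

Lemma uncountable_cantor : ~ countable [set: nat -> bool].
Proof.
move=> /countable_injP [f finj].
pose D (n : nat) := ~~ `[< exists2 x, f x = n & x n >].
have := erefl (D (f D)); rewrite {1}/D.
case: asboolP => /=.
  move=> [x E xD]; have Ex : x = D by apply: finj E; rewrite inE.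
  by rewrite Ex in xD; rewrite xD.
move=> H /esym DD; apply: H; by exists D.
Qed.

(** Were it countable, it could not be everything, and the least point outside
    it would have countably many predecessors, hence belong to it. *)
Lemma uncountable_omega1 : ~ countable [set: omega1].
Proof.
move=> W_ctbl.
pose P := [set x | countable [set y | cantor_wo y x /\ y <> x]].
have Pctbl : countable P by apply: countable_sub.
case: (pselect (exists x, ~ P x)) => [[x nPx]|allP].
  have [|m [[mP mlb] _]] := cantor_woP (A := [pred x | `[< ~ P x >]]).
    by exists x; rewrite inE.
  move: mP; rewrite inE; apply.
  apply: (countable_preimage_inj (f := id) _ _ Pctbl) => // y [ym ynm].
  apply: contrapT => nPy; apply: ynm; apply: cantor_wo_anti.
  by rewrite ym mlb // inE.
apply: uncountable_cantor.
apply: (countable_preimage_inj (f := id) _ _ Pctbl) => //.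
by move=> x _; apply: contrapT => nPx; apply: allP; exists x.
Qed.

(** A countable union of countable initial segments does not exhaust omega_1. *)
Lemma omega1_bound (A : set omega1) :
  countable A -> exists b, forall a, A a -> a < b.
Proof.
move=> Actbl; apply: contrapT => unb; apply: uncountable_omega1.
have -> : [set: omega1] = \bigcup_(a in A) ([set b | b < a] `|` [set a]).
  apply/seteqP; split => // b _; apply: contrapT => nb; apply: unb.
  exists b => a Aa; rewrite ltNge; apply/negP => ba; apply: nb; exists a => //.
  by move: ba; rewrite le_eqVlt => /orP[/eqP->|]; [right|left].
apply: bigcup_countable => // a _; rewrite -bigcup2E.
apply: bigcup_countable => // -[|[|n]] _ //=.
exact: countable_below.
Qed.

Lemma omega1_wf : well_founded (fun a b : omega1 => a < b).
Proof.
move=> a; apply: contrapT => na.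
have [|m nm mlb] := @omega1_min [set b | ~ Acc (fun a b : omega1 => a < b) b].
  by exists a.
apply: nm; constructor => b bm; apply: contrapT => nb.
by have := mlb b nb; rewrite leNgt bm.
Qed.

(** * A coherent family of finite-to-one maps *)

Definition code (b : omega1) : omega1 -> nat :=
  sval (cid (elimT (countable_injP _) (countable_below b))).

Lemma code_inj b x y : x < b -> y < b -> code b x = code b y -> x = y.
Proof.
move=> xb yb.
have := svalP (cid (elimT (countable_injP _) (countable_below b))).
by apply; rewrite inE.
Qed.

Lemma finite_code_le b n : finite_set [set c | c < b /\ (code b c <= n)%N].
Proof.
apply: (@sub_finite_set _ _
    (\bigcup_(k in `I_n.+1) [set c | c < b /\ code b c = k])).
  by move=> c [cb cn]; exists (code b c).
apply: bigcup_finite => // k _.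
case: (pselect (exists c, c < b /\ code b c = k)) => [[c [cb ck]]|none].
  apply: (@sub_finite_set _ _ [set c]) => // x [xb xk].
  by apply: code_inj xb cb _; rewrite xk.
by apply: (@sub_finite_set _ _ set0) => // x xk; case: none; exists x.
Qed.

Lemma exists_step b z : z < b -> exists c,
  [/\ z <= c, c < b & forall x, z <= x -> x < b -> (code b c <= code b x)%N].
Proof.
move=> zb; pose P n := `[< exists c, [/\ z <= c, c < b & code b c = n] >].
have exP : exists n, P n by exists (code b z); apply/asboolP; exists z.
case: (ex_minnP exP) => n /asboolP [c [zc cb cn]] nmin.
exists c; split=> // x zx xb; rewrite cn; apply: nmin; apply/asboolP.
by exists x.
Qed.

(** The ladder at [b] consists of the running maxima of the predecessors of [b]
    listed in the order of their codes; [step b z] is its first term that is at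
    least [z], so that iterating [step] walks from [b] down to [z].  Successors
    and limits need no separate treatment. *)
Definition step (b z : omega1) : omega1 :=
  if pselect (z < b) is left zb then sval (cid (exists_step zb)) else z.

Lemma stepP b z : z < b ->
  [/\ z <= step b z, step b z < b &
      forall x, z <= x -> x < b -> (code b (step b z) <= code b x)%N].
Proof.
by rewrite /step => zb; case: pselect => // zb'; case: (cid _).
Qed.

Definition walk_body (b : omega1) (walk : forall c, c < b -> omega1 -> nat)
    (z : omega1) : nat :=
  if pselect (step b z < b) is left cb then
    maxn (code b (step b z)) (if step b z == z then 0 else walk _ cb z)
  else 0.

(** The largest code met while walking from [b] down to [z]. *)
Definition walk : omega1 -> omega1 -> nat := Fix omega1_wf _ walk_body.

Lemma walkE b z : z < b ->
  walk b z = maxn (code b (step b z))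
    (if step b z == z then 0 else walk (step b z) z).
Proof.
move=> zb; rewrite {1}/walk Fix_eq.
  rewrite {1}/walk_body; case: pselect => // -[].
  by case: (stepP zb).
move=> x f g fg; suff -> : f = g by [].
apply: functional_extensionality_dep => c.
by apply: functional_extensionality_dep => cx; apply: fg.
Qed.

(** The first step of a walk of weight at most [n] has code at most [n], which
    leaves finitely many choices, and the rest of the walk is governed by the
    induction hypothesis. *)
Lemma finite_walk_le b n : finite_set [set z | z < b /\ (walk b z <= n)%N].
Proof.
elim/(well_founded_ind omega1_wf): b n => b IH n.
apply: (@sub_finite_set _ _ (\bigcup_(c in [set c | c < b /\ (code b c <= n)%N])
    ([set c] `|` [set z | z < c /\ (walk c z <= n)%N]))).
  move=> z [zb]; rewrite walkE // geq_max => /andP[cn].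
  have [zc cb _] := stepP zb; case: eqP => [E _|/eqP nE wn].
    by exists (step b z); [|left].
  by exists (step b z) => //; right; split=> //; rewrite lt_neqAle eq_sym nE.
apply: bigcup_finite; first exact: finite_code_le.
by move=> c [cb _]; rewrite finite_setU; split=> //; apply: IH.
Qed.

(** Let [x < c].  For [z < x], the first step from [c] towards [z] has code at
    most that of [x], since [x] is itself a candidate; so only finitely many
    first steps [y] occur.  For a fixed [y], the value [walk c z] equals
    [walk y z] except for [z = y] and for the finitely many [z] where the latter
    is below the code of [y], and [walk y] is coherent with [walk x] by
    induction. *)
Lemma walk_coherent a b :
  finite_set [set z | [/\ z < a, z < b & walk a z <> walk b z]].
Proof.
have below (c : omega1) : forall x, x < c ->
    finite_set [set z | [/\ z < x, z < c & walk x z <> walk c z]]; last first.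
  case: (ltgtP a b) => [ab|ba|->]; first exact: below.
    by apply: sub_finite_set (below _ _ ba) => z [za zb /nesym].
  by apply: (@sub_finite_set _ _ set0) => // z [].
elim/(well_founded_ind omega1_wf): c => c IH x xc.
pose D := [set y | y < c /\ (code c y <= code c x)%N].
apply: (@sub_finite_set _ _ (\bigcup_(y in D) ([set y] `|`
    [set z | z < y /\ (walk y z <= code c y)%N] `|`
    [set z | [/\ z < x, z < y & walk x z <> walk y z]]))).
  move=> z [zx zc]; rewrite (walkE zc); have [zy yc ymin] := stepP zc.
  have Dy : D (step c z) by split=> //; apply: ymin => //; apply: ltW.
  case: eqP => [E _|/eqP nE]; first by exists (step c z) => //; left; left.
  have {}zy : z < step c z by rewrite lt_neqAle eq_sym nE.
  case: (leqP (walk (step c z) z) (code c (step c z))) => [le _|_ ne].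
    by exists (step c z) => //; left; right.
  by exists (step c z) => //; right.
apply: bigcup_finite => [|y [yc _]]; first exact: finite_code_le.
rewrite !finite_setU; split; first by split=> //; apply: finite_walk_le.
case: (ltgtP x y) => [xy|yx|->]; first exact: IH.
  by apply: sub_finite_set (IH _ xc _ yx) => z [za zb /nesym].
by apply: (@sub_finite_set _ _ set0) => // z [].
Qed.

(** * The lines *)

(** The shift by one keeps the values positive, as 0 is reserved for marking
    the end of a function. *)
Definition trunk (b z : omega1) : rat := ((walk b z).+1%:R)%R.

Lemma trunk_gt0 b z : 0%R < trunk b z.
Proof. by rewrite /trunk ltr0Sn. Qed.

(** The sign condition is imposed on [S] only: it makes the end marker 0 the
    least value at coordinates in [S], and an interior one elsewhere. *)
Definition node (S : set omega1) (b : omega1) (t : omega1 -> rat) : Prop :=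
  [/\ forall z, z < b -> t z <> 0%R /\ (S z -> 0%R < t z),
      forall z, b <= z -> t z = 0%R &
      finite_set [set z | z < b /\ t z <> trunk b z]].

Lemma trunk_coherent a b :
  finite_set [set z | [/\ z < a, z < b & trunk a z <> trunk b z]].
Proof.
apply: sub_finite_set (walk_coherent a b) => z [za zb ne]; split=> // E.
by apply: ne; rewrite /trunk E.
Qed.

Lemma node_coherent S S' a b s t : node S a s -> node S' b t ->
  finite_set [set z | [/\ z < a, z < b & s z <> t z]].
Proof.
move=> [_ _ fs] [_ _ ft]; apply: (@sub_finite_set _ _
  ([set z | z < a /\ s z <> trunk a z] `|` [set z | z < b /\ t z <> trunk b z]
   `|` [set z | [/\ z < a, z < b & trunk a z <> trunk b z]])); last first.
  by rewrite !finite_setU; split=> //; apply: trunk_coherent.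
move=> z [za zb ne]; apply: contrapT => /not_orP[/not_orP[n1 n2] n3]; apply: ne.
transitivity (trunk a z); first by apply: contrapT => ?; apply: n1.
transitivity (trunk b z); first by apply: contrapT => ?; apply: n3.
by apply: contrapT => ?; apply: n2; split=> // /esym.
Qed.

(** The values of [trunk b] tend to infinity, as [walk b] is finite-to-one.
    Negative values of [t] occur only among the finitely many modifications. *)
Lemma node_finite_le S b t (n : nat) : node S b t ->
  finite_set [set z | z < b /\ t z <= (n%:R)%R].
Proof.
move=> [_ _ ft]; apply: (@sub_finite_set _ _
  ([set z | z < b /\ t z <> trunk b z] `|` [set z | z < b /\ (walk b z <= n)%N])).
  move=> z [zb tn]; case: (pselect (t z = trunk b z)) => [E|]; [right|by left].
  by split=> //; move: tn; rewrite E /trunk ler_nat => /ltnW.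
by rewrite finite_setU; split=> //; apply: finite_walk_le.
Qed.

Definition splice (t : omega1 -> rat) (x : omega1) (q : rat)
    (b z : omega1) : rat :=
  if z < x then t z else if z == x then q else
  if z < b then trunk b z else 0%R.

Lemma node_splice S a t x q b : node S a t -> x <= a -> x < b ->
  q <> 0%R -> (S x -> 0%R < q) -> node S b (splice t x q b).
Proof.
move=> tn xa xb q0 Sq; case: (tn) => tpos tzero tfin; split.
- move=> z zb; rewrite /splice; case: ifP => [zx|_].
    by apply: tpos; apply: lt_le_trans xa.
  case: eqP => [->//|_]; rewrite zb; split; last by rewrite trunk_gt0.
  by apply/eqP; rewrite gt_eqF // trunk_gt0.
- move=> z bz; have xz := lt_le_trans xb bz.
  by rewrite /splice ltNge (ltW xz) /= gt_eqF // ltNge bz.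
- apply: (@sub_finite_set _ _ ([set x] `|` ([set z | z < a /\ t z <> trunk a z]
    `|` [set z | [/\ z < a, z < b & trunk a z <> trunk b z]]))); last first.
    by rewrite !finite_setU; split=> //; split=> //; apply: trunk_coherent.
  move=> z [zb]; rewrite /splice; case: ifP => [zx ne|_]; last first.
    by case: eqP => [-> _|_]; [left|rewrite zb].
  right; have za := lt_le_trans zx xa.
  case: (pselect (t z = trunk a z)) => [E|?]; [right|by left].
  by split=> //; rewrite -E.
Qed.

Definition truncate (t : omega1 -> rat) (b z : omega1) : rat :=
  if z < b then t z else 0%R.

Lemma node_truncate S a t b : node S a t -> b <= a -> node S b (truncate t b).
Proof.
move=> [tpos tzero tfin] ba; rewrite /truncate; split.
- by move=> z zb; rewrite zb; apply: tpos; apply: lt_le_trans ba.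
- by move=> z bz; rewrite ltNge bz.
- apply: (@sub_finite_set _ _ ([set z | z < a /\ t z <> trunk a z]
    `|` [set z | [/\ z < a, z < b & trunk a z <> trunk b z]])); last first.
    by rewrite !finite_setU; split=> //; apply: trunk_coherent.
  move=> z [zb]; rewrite zb => ne; have za := lt_le_trans zb ba.
  case: (pselect (t z = trunk a z)) => [E|?]; [right|by left].
  by split=> //; rewrite -E.
Qed.

Lemma node_trunk S b : node S b (truncate (trunk b) b).
Proof.
rewrite /truncate; split.
- move=> z zb; rewrite zb; split; last by rewrite trunk_gt0.
  by apply/eqP; rewrite gt_eqF // trunk_gt0.
- by move=> z bz; rewrite ltNge bz.
- by apply: (@sub_finite_set _ _ set0) => // z [zb]; rewrite zb.
Qed.

Lemma node_height_inj S a b t : node S a t -> node S b t -> a = b.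
Proof.
move=> [apos azero _] [bpos bzero _].
by case: (ltgtP a b) => // [/bpos|/apos] [] h _; exfalso; apply: h;
  [apply: azero|apply: bzero].
Qed.

(** The display is a phantom parameter, used by the order instance below. *)
Definition line (d : Order.disp_t) (S : set omega1) : Type :=
  {t : omega1 -> rat | `[< exists b, node S b t >]}.

HB.instance Definition _ d S := Choice.on (line d S).

Section Line.
Variables (d : Order.disp_t) (S : set omega1).

Definition label (x : line d S) : omega1 -> rat := val x.
Coercion label : line >-> Funclass.

Definition mkline b t (tn : node S b t) : line d S :=
  exist _ t (asboolT (ex_intro (fun b => node S b t) b tn)).

Definition ht (x : line d S) : omega1 :=
  sval (cid (elimT (asboolP _) (svalP x))).

Lemma htP x : node S (ht x) x.
Proof. by rewrite /ht; case: (cid _). Qed.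

Lemma label_inj : injective label.
Proof. exact: val_inj. Qed.

Lemma ht_mkline b t (tn : node S b t) : ht (mkline tn) = b.
Proof. exact: (node_height_inj (htP (mkline tn)) tn). Qed.

Lemma label0 (x : line d S) z : (x z = 0%R) <-> (ht x <= z).
Proof.
have [pos zero _] := htP x; split; last exact: zero.
by move=> x0; rewrite leNgt; apply/negP => /pos[].
Qed.

Lemma label_ge0 (x : line d S) z : S z -> 0%R <= x z.
Proof.
have [pos zero _] := htP x; move=> Sz.
case: (ltP z (ht x)) => [/pos[_ /(_ Sz)/ltW//]|/zero ->]; exact: lexx.
Qed.

Definition agree (x y : line d S) (z : omega1) : Prop :=
  forall w, w < z -> x w = y w.

Definition line_lt (x y : line d S) : bool :=
  `[< exists2 z, agree x y z & x z < y z >].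

Lemma first_difference (x y : line d S) :
  x <> y -> exists2 z, agree x y z & x z <> y z.
Proof.
move=> ne; have [|z nz zmin] := @omega1_min [set z | x z <> y z].
  apply: contrapT => nex; apply: ne; apply: label_inj; apply/funext => z.
  by apply: contrapT => nz; apply: nex; exists z.
exists z => // w wz; apply: contrapT => nw.
by have := zmin w nw; rewrite leNgt wz.
Qed.

Lemma line_lt_irr : irreflexive line_lt.
Proof. by move=> x; apply/asboolP => -[z _]; rewrite ltxx. Qed.

Lemma line_lt_trans : transitive line_lt.
Proof.
move=> y x z /asboolP[v xy xyv] /asboolP[w yz yzw]; apply/asboolP.
case: (ltgtP v w) => [vw|wv|E].
- exists v; last by rewrite -yz.
  by move=> u uv; rewrite xy // yz // (lt_trans uv).
- exists w; last by rewrite xy.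
  by move=> u uw; rewrite xy ?yz // (lt_trans uw).
- subst w; exists v; last exact: lt_trans xyv yzw.
  by move=> u uv; rewrite xy ?yz.
Qed.

HB.instance Definition _ :=
  Order.Lt_isPOrder.Build d (line d S) line_lt_irr line_lt_trans.

Lemma line_ltP (x y : line d S) :
  reflect (exists2 z, agree x y z & x z < y z) (x < y).
Proof. exact: asboolP. Qed.

Lemma line_le_total : total (fun x y : line d S => x <= y).
Proof.
move=> x y; have [->|/eqP ne] := eqVneq x y; first by rewrite lexx.
have [z xy] := first_difference ne.
case: (ltgtP (x z) (y z)) => // xyz _; apply/orP; [left|right]; apply/ltW/line_ltP.
  by exists z.
by exists z => // w wz; rewrite xy.
Qed.

HB.instance Definition _ :=
  Order.POrder_isTotal.Build d (line d S) line_le_total.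

End Line.

(** * Interpolation and cardinality *)

Lemma omega1_gt (a : omega1) : exists b, a < b.
Proof.
have [b /(_ a erefl) ab] := omega1_bound (countable1 a).
by exists b.
Qed.

Section LineTheory.
Variables (d : Order.disp_t) (S : set omega1).
Implicit Types x y c : line d S.

Lemma agree_ht x y z : agree x y z -> x z < y z -> z <= ht x.
Proof.
move=> xy; apply: contraTT; rewrite -ltNge => xz.
have x0 : x (ht x) = 0%R by apply/label0.
have y0 : y z = 0%R.
  by apply/label0; apply: le_trans (ltW xz); apply/label0; rewrite -xy.
by rewrite y0 (_ : x z = 0%R) ?ltxx //; apply/label0/ltW.
Qed.

Lemma line_splice x z b q : z <= ht x -> z < b -> q <> 0%R ->
  (S z -> 0%R < q) -> exists c, [/\ ht c = b, agree x c z & c z = q].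
Proof.
move=> zx zb q0 Sq; exists (mkline d (node_splice (htP x) zx zb q0 Sq)).
split; first exact: ht_mkline.
  by move=> w wz; rewrite /label /= /splice wz.
by rewrite /label /= /splice ltxx eqxx.
Qed.

(** The value chosen at the first difference must avoid 0, and it is then
    positive when required: on [S] it exceeds [x z], which is nonnegative. *)
Lemma line_between x y z b : agree x y z -> x z < y z -> z < b ->
  exists c, [/\ ht c = b, x < c & c < y].
Proof.
move=> xy xyz zb.
have [q [q0 xq qy]] : exists q : rat, [/\ q <> 0, x z < q & q < y z]%R.
  (* The midpoint serves unless it is 0, and then half of [y z] does. *)
  pose m := ((x z + y z) / 2)%R.
  have [/eqP m0|m0] := boolP (m == 0%R); last first.
    exists m; split; [exact/eqP|exact: (midf_lt xyz).1|exact: (midf_lt xyz).2].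
  have yz0 : (0 < y z)%R.
    rewrite ltNge; apply/negP => y0.
    have : (m < 0)%R by apply: lt_le_trans y0; exact: (midf_lt xyz).2.
    by rewrite m0 ltxx.
  have xz0 : (x z < 0)%R by rewrite -m0; exact: (midf_lt xyz).1.
  have h := midf_lt yz0.
  exists ((0 + y z) / 2)%R; split; [|exact: lt_trans xz0 h.1|exact: h.2].
  by apply/eqP; rewrite gt_eqF // h.1.
have [|c [cb xc cz]] := @line_splice x z b q (agree_ht xy xyz) zb q0.
  by move=> Sz; apply: le_lt_trans xq; apply: label_ge0.
exists c; split=> //; apply/line_ltP; exists z; rewrite ?cz //.
by move=> w wz; rewrite -xc // xy.
Qed.

(** The finite set of modifications of the trunk, which together with the height
    determines the point. *)
Definition graph x : set (omega1 * rat) :=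
  [set p | [/\ p.1 < ht x, x p.1 <> trunk (ht x) p.1 & p.2 = x p.1]].

Lemma graph_inj x y : ht x = ht y -> graph x = graph y -> x = y.
Proof.
move=> hxy gxy; apply: label_inj; apply/funext => z.
case: (leP (ht x) z) => [xz|zx].
  by transitivity (0%R : rat); [|apply: esym]; apply/label0; rewrite -?hxy.
case: (pselect (x z = trunk (ht x) z)) => [xt|xt].
  apply: contrapT => ne.
  have : graph y (z, y z).
    split=> //=; rewrite -hxy // => yt.
    by apply: ne; rewrite xt yt.
  by rewrite -gxy => -[_ /= _ /esym].
have : graph x (z, x z) by [].
by rewrite gxy => -[_ /= _].
Qed.

Lemma countable_level b : countable [set x : line d S | ht x = b].
Proof.
apply: (countable_preimage_inj (f := graph)
  (B := [set A | A `<=` [set c | c < b] `*` setT /\ finite_set A])).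
- by move=> x y /= xb yb; apply: graph_inj; rewrite xb.
- move=> x /= xb; split; first by move=> p [pb _ _]; split=> //; rewrite /= -xb.
  have [_ _] := htP x => /(finite_image (fun z => (z, x z))).
  apply: sub_finite_set => -[z q] [/= zb ne ->]; exists z => //.
- apply: countable_finite_subset; apply: countableX; last exact: countableP.
  exact: countable_below.
Qed.

Definition level_code x : nat :=
  sval (cid (elimT (countable_injP _) (countable_level (ht x)))) x.

Lemma level_code_inj x y : ht x = ht y -> level_code x = level_code y -> x = y.
Proof.
move=> hxy; rewrite /level_code hxy; case: (cid _) => f /= finj.
by apply: finj; rewrite inE.
Qed.

(** As each level is countable, a numbering of the levels refines the comparison
    of heights to a well-order of type omega_1. *)
Definition line_wo x y : bool :=
  (ht x < ht y) || (ht x == ht y) && (level_code x <= level_code y)%N.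

Lemma line_wo_anti : antisymmetric line_wo.
Proof.
move=> x y; rewrite /line_wo.
case: (ltgtP (ht x) (ht y)) => //= hxy /andP[xy yx].
by apply: level_code_inj => //; apply/eqP; rewrite eqn_leq xy.
Qed.

Lemma countable_upto b : countable [set x : line d S | ht x <= b].
Proof.
have -> : [set x : line d S | ht x <= b] =
    \bigcup_(c in [set c | c <= b]) [set x : line d S | ht x = c].
  by apply/seteqP; split=> [x xb|x [c cb xc]]; [exists (ht x)|rewrite /= xc].
apply: bigcup_countable => [|c _]; last exact: countable_level.
have [b' bb'] := omega1_gt b.
apply: (countable_preimage_inj (f := id) _ _ (countable_below b')) => // c cb.
exact: le_lt_trans bb'.
Qed.

Lemma size_aleph1_line (A : set (line d S)) : ~ countable A -> size_aleph1 A.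
Proof.
move=> unc; exists line_wo; split=> //.
- apply: antisymmetric_wo_chain => [x y _ _|B _ [x0 Bx0]].
    exact: line_wo_anti.
  have [|_ [x1 Bx1 <-] hmin] := @omega1_min (@ht d S @` [set x | x \in B]).
    by exists (ht x0); exists x0.
  pose P n := `[< exists x, [/\ x \in B, ht x = ht x1 & level_code x = n] >].
  have exP : exists n, P n by exists (level_code x1); apply/asboolP; exists x1.
  case: (ex_minnP exP) => n /asboolP [x [Bx hx xn]] nmin; exists x; split=> // y By.
  have := hmin (ht y) (ex_intro2 _ _ y By erefl).
  rewrite /line_wo hx le_eqVlt => /orP[/eqP E|->//].
  by rewrite E eqxx xn nmin ?orbT //; apply/asboolP; exists y.
- move=> a _.
  apply: (countable_preimage_inj (f := id) _ _ (countable_upto (ht a))) => //.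
  move=> x [_ xa _] /=; case/orP: xa => [/ltW//|/andP[/eqP -> _]]; exact: lexx.
Qed.

(** A countable set of points has bounded heights. *)
Lemma unbounded_uncountable (A : set (line d S)) (b : omega1) :
  (forall c : omega1, b <= c -> exists2 x, A x & ht x = c) -> ~ countable A.
Proof.
move=> Ab Actbl.
have [c cb] := omega1_bound (sub_countable (card_image_le (@ht d S) A) Actbl).
have [|x Ax xm] := Ab (Order.max b c); first by rewrite le_max lexx.
have := cb (ht x) (ex_intro2 _ _ x Ax erefl).
by rewrite xm ltNge le_max lexx orbT.
Qed.

Lemma exists_ht b : exists x, ht x = b.
Proof. by exists (mkline d (node_trunk S b)); apply: ht_mkline. Qed.

Lemma uncountable_line : ~ countable [set: line d S].
Proof.
have [b _] := omega1_bound (countable0 omega1).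
apply: (@unbounded_uncountable _ b) => c _.
by have [x xc] := exists_ht c; exists x.
Qed.
End LineTheory.

(** * Density and the Countryman property *)

(** Outside [S] the labels at [z] are unbounded below, so no point is least
    among those that agree with it below [z]. *)
Lemma line_lower (d : Order.disp_t) (S : set omega1) (x : line d S) z :
  z <= ht x -> ~ S z -> exists2 c, agree x c z & c < x.
Proof.
move=> zx nSz; pose q := (Num.min 0 (x z) - 1)%R.
have q0 : (q < 0)%R by rewrite subr_lt0 (le_lt_trans _ ltr01) // ge_min lexx.
have qx : (q < x z)%R by rewrite ltrBlDr gt_min ltrDl ltr01 orbT.
have [b zb] := omega1_gt z.
have [||c [_ cx cq]] := line_splice (q := q) zx zb.
- by apply/eqP; rewrite lt_eqF.
- by move/nSz.
exists c => //; apply/line_ltP.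
by exists z; rewrite ?cq // => w wz; exact/esym/cx.
Qed.

Lemma line_upper (d : Order.disp_t) (S : set omega1) (x : line d S) z :
  z <= ht x -> exists2 c, agree x c z & x < c.
Proof.
move=> zx; pose q := (Num.max 0 (x z) + 1)%R.
have q0 : (0 < q)%R by rewrite ltr_wpDl // le_max lexx.
have qx : (x z < q)%R.
  apply: (@le_lt_trans _ _ (Num.max 0 (x z))%R); last by rewrite ltrDl.
  by rewrite le_max lexx orbT.
have [b zb] := omega1_gt z.
have [||c [_ cx cq]] := line_splice (q := q) zx zb => //.
  by apply/eqP; rewrite gt_eqF.
by exists c => //; apply/line_ltP; exists z; rewrite ?cq.
Qed.

Lemma aleph1_dense_line (d : Order.disp_t) (S : set omega1) :
  (forall z, S z -> exists w, w < z) -> aleph1_dense (line d S : orderType d).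
Proof.
move=> S0; have [b0 _] := omega1_bound (countable0 omega1).
have [z0 _ z0min] := @omega1_min [set: omega1] (ex_intro _ b0 I).
have nSz0 : ~ S z0 by move=> /S0[w]; rewrite ltNge z0min.
split.
- by have [x _] := exists_ht d S b0; exists x.
- by move=> [x xmin]; have [c _] := line_lower (z0min (ht x) I) nSz0; rewrite ltNge xmin.
- by move=> [x xmax]; have [c _] := line_upper (z0min (ht x) I); rewrite ltNge xmax.
- move=> x y /line_ltP[z xy xyz]; apply: size_aleph1_line.
  have [b zb] := omega1_gt z.
  apply: (@unbounded_uncountable _ _ _ b) => c bc.
  have [e [ec xe ey]] := line_between xy xyz (lt_le_trans zb bc).
  by exists e; rewrite //= !ltW.
Qed.

Lemma finite_bounded (A : set omega1) (f : omega1 -> rat) :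
  finite_set A -> exists n : nat, forall z, A z -> f z <= (n%:R)%R.
Proof.
move=> /finite_seqP[s ->]; elim: s => [|w s [n hn]]; first by exists 0.
exists (maxn n (Num.bound `|f w|%R)) => z /=.
rewrite inE => /orP[/eqP ->|zs].
  apply: le_trans (ler_norm _) _; apply: le_trans (ltW (archi_boundP _)) _ => //.
  by rewrite ler_nat leq_maxr.
by apply: le_trans (hn z zs) _; rewrite ler_nat leq_maxl.
Qed.

Lemma finite_sorted (A : set omega1) : finite_set A ->
  exists2 s : seq omega1, sorted <%O s & forall z, (z \in s) <-> A z.
Proof.
move=> /finite_seqP[s ->]; exists (sort <=%O (undup s)).
  by rewrite sort_lt_sorted undup_uniq.
by move=> z; rewrite mem_sort mem_undup.
Qed.

(** The last hypothesis gives [x] the same position in the two sorted lists. *)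
Lemma sorted_map_agree (U : Type) (f f' : omega1 -> U) (s s' : seq omega1) x :
  sorted <%O s -> sorted <%O s' -> map f s = map f' s' ->
  x \in s -> x \in s' -> (forall w, w < x -> (w \in s) = (w \in s')) ->
  f x = f' x.
Proof.
elim: s s' => [//|a s IH] [//|a' s'] /= ss ss' [fa fs] xs xs' same.
have lt_s w : w \in s -> a < w by move/allP: (order_path_min lt_trans ss); apply.
have lt_s' w : w \in s' -> a' < w by move/allP: (order_path_min lt_trans ss'); apply.
have aa' : a = a'.
  move: xs xs'; rewrite !inE => /orP[/eqP xa|xs] /orP[/eqP xa'|xs'].
  - by rewrite -xa.
  - have := same _ (lt_s' _ xs'); rewrite !inE eqxx /= => /orP[/eqP//|/lt_s].
    by move: (lt_s' _ xs'); rewrite xa => /lt_trans h /h; rewrite ltxx.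
  - have := same _ (lt_s _ xs); rewrite !inE eqxx /= => /esym/orP[/eqP//|/lt_s'].
    by move: (lt_s _ xs); rewrite xa' => /lt_trans h /h; rewrite ltxx.
  - have := same _ (lt_s _ xs); rewrite !inE eqxx /= => /esym/orP[/eqP//|/lt_s' a'a].
    have := same _ (lt_s' _ xs'); rewrite !inE eqxx /= => /orP[/eqP//|/lt_s].
    by move=> /(lt_trans a'a); rewrite ltxx.
subst a'; move: xs xs'; rewrite !inE.
have [->//|xa /= xs xs'] := eqVneq x a.
apply: (IH s') => //; [exact: path_sorted ss|exact: path_sorted ss'|].
move=> w wx; have := same w wx; rewrite !inE.
have [->|//] := eqVneq w a.
have -> : (a \in s) = false by apply/negP => /lt_s; rewrite ltxx.
by have -> : (a \in s') = false by apply/negP => /lt_s'; rewrite ltxx.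
Qed.

Section Countryman.
Variables (d : Order.disp_t) (S : set omega1).
Implicit Types x y : line d S.

(** Up to the height of [x], the list [s] consists of the places where [x] is at
    most [n], which are also those where [y] is at most [n]; elsewhere the two
    points agree.  Since [x] is 0 at its height, [s] contains that place. *)
Definition profile x y (n : nat) (s : seq omega1) : Prop :=
  [/\ sorted <%O s,
      forall z, z <= ht x -> (z \in s) = (x z <= n%:R)%R,
      forall z, z <= ht x -> (z \in s) = (y z <= n%:R)%R &
      forall z, z <= ht x -> z \notin s -> x z = y z].

(** It suffices that [n] bounds both points on their finitely many disagreements
    and at the height of [x]: a place where they agree causes no conflict. *)
Lemma exists_profile x y : ht x <= ht y -> exists p, profile x y p.1 p.2.
Proof.
move=> xy.
pose D := [set ht x] `|` [set z | [/\ z < ht x, z < ht y & x z <> y z]].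
have Dfin : finite_set D.
  rewrite /D finite_setU; split=> //; apply: node_coherent (htP x) (htP y).
have [nx xn] := finite_bounded x Dfin; have [ny yn] := finite_bounded y Dfin.
pose n := maxn nx ny.
have {}xn z : D z -> (x z <= n%:R)%R.
  by move=> /xn /le_trans; apply; rewrite ler_nat leq_maxl.
have {}yn z : D z -> (y z <= n%:R)%R.
  by move=> /yn /le_trans; apply; rewrite ler_nat leq_maxr.
have eqD z : z <= ht x -> ~ D z -> x z = y z.
  rewrite le_eqVlt => /orP[/eqP -> nD|zx nD]; first by case: nD; left.
  by apply: contrapT => ne; apply: nD; right; split=> //; apply: lt_le_trans xy.
have [|s ss sE] := @finite_sorted [set z | z <= ht x /\ (x z <= n%:R)%R].
  apply: (@sub_finite_set _ _ ([set ht x] `|` [set z | z < ht x /\ (x z <= n%:R)%R])).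
    by move=> z [zx xz]; move: zx; rewrite le_eqVlt => /orP[/eqP|]; [left|right].
  by rewrite finite_setU; split=> //; apply: node_finite_le (htP x).
have sx z : z <= ht x -> (z \in s) = (x z <= n%:R)%R.
  by move=> zx; apply/idP/idP => [/sE[]|xz] //; apply/sE.
exists (n, s); split=> //= z.
- move=> zx; rewrite sx //.
  case: (pselect (D z)) => [Dz|/eqD -> //]; by rewrite xn // yn.
- by move=> zx zs; apply: eqD => // Dz; move: zs; rewrite sx // xn.
Qed.

(** Let [z] be the first difference of [x] and [x'].  The lists coincide below
    [z], so they also determine the same values of [y] and [y'] there: by
    position on the lists, and through [x] and [x'] off them.  At [z], equal
    positions on both lists would give equal values; on neither list [y] and
    [y'] copy [x] and [x']; and if [z] is on one list only, then one value is at
    most [n] and the other larger, both for the first and for the second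
    components. *)
Lemma profile_mono x y x' y' n s s' :
  profile x y n s -> profile x' y' n s' ->
  [seq (x z, y z) | z <- s] = [seq (x' z, y' z) | z <- s'] ->
  x < x' -> y < y'.
Proof.
move=> [ss sx sy sN] [ss' sx' sy' sN'] E /line_ltP[z xx' xz].
have zx := agree_ht xx' xz.
have zx' : z <= ht x'.
  rewrite leNgt; apply/negP => x'z.
  have x0 : x (ht x') = 0%R by rewrite xx' //; apply/label0.
  have hx : ht x <= ht x' by apply/label0.
  by have := le_lt_trans (le_trans zx hx) x'z; rewrite ltxx.
have same w : w < z -> (w \in s) = (w \in s').
  move=> wz; rewrite sx ?sx' ?xx' //; apply: ltW; exact: lt_le_trans wz _.
apply/line_ltP; exists z.
  move=> w wz; have wx := le_trans (ltW wz) zx; have wx' := le_trans (ltW wz) zx'.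
  have [ws|ws] := boolP (w \in s).
    have ws' : w \in s' by rewrite -same.
    have same' v : v < w -> (v \in s) = (v \in s').
      by move=> vw; apply: same; apply: lt_trans wz.
    by have [_ ->] := sorted_map_agree ss ss' E ws ws' same'.
  by rewrite -sN // xx' // sN' // -same.
have [zs|zs] := boolP (z \in s); have [zs'|zs'] := boolP (z \in s').
- have [xzE _] := sorted_map_agree ss ss' E zs zs' same.
  by move: xz; rewrite xzE ltxx.
- move: zs zs'; rewrite sy // sy' // -ltNge; exact: le_lt_trans.
- move: zs zs'; rewrite sx // sx' // -ltNge => a b.
  by have := lt_trans (le_lt_trans b a) xz; rewrite ltxx.
- by rewrite -sN // -sN'.
Qed.

Definition profile_of x y : nat * seq omega1 :=
  if pselect (ht x <= ht y) is left xy then sval (cid (exists_profile xy))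
  else (0, [::]).

Lemma profile_ofP x y :
  ht x <= ht y -> profile x y (profile_of x y).1 (profile_of x y).2.
Proof. by rewrite /profile_of => xy; case: pselect => // h; case: (cid _). Qed.

(** Unlike the profile itself, the color ranges over a countable type: only the
    values along the list are retained, not the places. *)
Definition color x y : nat * seq (rat * rat) :=
  ((profile_of x y).1, [seq (x z, y z) | z <- (profile_of x y).2]).

Lemma color_mono x y x' y' : ht x <= ht y -> ht x' <= ht y' ->
  color x y = color x' y' -> x < x' -> y < y'.
Proof.
move=> /profile_ofP p /profile_ofP p' [n E].
by rewrite n in p; apply: profile_mono p p' E.
Qed.

Definition pair_color (p : line d S * line d S) : bool * (nat * seq (rat * rat)) :=
  if ht p.1 <= ht p.2 then (true, color p.1 p.2) else (false, color p.2 p.1).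

Lemma same_color_total x y x' y' : pair_color (x, y) = pair_color (x', y') ->
  (x <= x') && (y <= y') || (x' <= x) && (y' <= y).
Proof.
rewrite /pair_color /=; case: (leP (ht x) (ht y)) => xy;
  case: (leP (ht x') (ht y')) => xy' // /(congr1 snd) E; have E' := esym E.
- case: (ltgtP x x') => [xx'|x'x|_]; last exact: le_total.
    by rewrite (ltW (color_mono xy xy' E xx')).
  by rewrite (ltW (color_mono xy' xy E' x'x)) orbT.
- have yx := ltW xy; have yx' := ltW xy'.
  case: (ltgtP y y') => [yy'|y'y|_]; last by rewrite !andbT le_total.
    by rewrite (ltW (color_mono yx yx' E yy')).
  by rewrite (ltW (color_mono yx' yx E' y'y)) orbT.
Qed.

Lemma countryman_line : countryman (line d S : orderType d).
Proof.
split; first exact: uncountable_line.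
exists (fun n => [set p | pickle (pair_color p) = n]); split=> [n|].
  move=> [x y] [x' y'] /= <- /(pcan_inj pickleK)/esym /same_color_total.
  by rewrite !leEprod /=; case/orP; [left|right].
by apply/seteqP; split => // p _; exists (pickle (pair_color p)).
Qed.

End Countryman.

(** * Disjoint stationary sets and epimorphisms *)

Definition closed_under (phi : omega1 -> omega1) (b : omega1) : Prop :=
  forall z, z < b -> phi z < b.

(** For sets omitting 0 this is the usual notion.  The nonzero ordinals closed
    under a function form a club; conversely, if [phi z] is an element of a given
    club above [z], then a nonzero ordinal closed under [phi] is a limit of
    elements of the club. *)
Definition stationary (S : set omega1) : Prop :=
  forall phi, exists2 b, S b & closed_under phi b.

(** The least strict upper bound of [a, f a, f (f a), ...] is closed, for [f]
    dominating [phi] on initial segments. *)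
Lemma closure_point phi a : exists2 b, a < b & closed_under phi b.
Proof.
have /choice [f fP] b : exists c, forall z, z <= b -> phi z < c.
  have [b' bb'] := omega1_gt b.
  have [c cP] := omega1_bound
    (sub_countable (card_image_le phi _) (countable_below b')).
  exists c => z zb; apply: cP; exists z => //=; exact: le_lt_trans bb'.
pose u n := iter n f a.
have [c0 c0P] := omega1_bound
  (sub_countable (card_image_le u _) (countableP [set: nat])).
have [|b bP bmin] := @omega1_min [set c | forall n, u n < c].
  by exists c0 => n; apply: c0P; exists n.
exists b => [|z zb]; first exact: (bP 0).
have [n zn] : exists n, z <= u n.
  apply: contrapT => none.
  suff zn : forall n, u n < z by have := bmin z zn; rewrite leNgt zb.
  by move=> n; rewrite ltNge; apply/negP => zn; apply: none; exists n.
by apply: lt_trans (bP n.+1); apply: fP.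
Qed.

(** The sets in question, for all [n], cover the ordinals above [a].  If each of
    them missed the closure points of some [phi n], a function dominating all
    the [phi n] would have no closure point above [a]. *)
Lemma exists_stationary_code a :
  exists n, stationary [set b | a < b /\ code b a = n].
Proof.
apply: contrapT => none.
have /choice [phi phiP] n : exists phi, forall b, a < b -> code b a = n ->
    ~ closed_under phi b.
  apply: contrapT => nphi; apply: none; exists n => phi.
  apply: contrapT => nb; apply: nphi; exists phi => b ab bn cl.
  by apply: nb; exists b.
have /choice [psi psiP] z : exists c, forall n, phi n z < c.
  have [c cP] := omega1_bound
    (sub_countable (card_image_le (phi ^~ z) _) (countableP [set: nat])).
  by exists c => n; apply: cP; exists n.
have [b ab bcl] := closure_point psi a.
apply: (phiP (code b a) b) => // z zb.
by apply: lt_trans (psiP z _) _; apply: bcl.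
Qed.

(** For each [a] some entry of its row of the Ulam matrix is stationary, and
    uncountably many [a] share the column [n] of such an entry; within a column
    the entries are disjoint because each [code b] is injective. *)
Lemma ulam_stationary : exists (A : set omega1) (S : omega1 -> set omega1),
  [/\ ~ countable A,
      forall a, A a -> stationary (S a) /\ (forall z, S a z -> a < z) &
      forall a b z, S a z -> S b z -> a = b].
Proof.
have /choice [f fP] := exists_stationary_code.
have [n nunc] : exists n, ~ countable [set a | f a = n].
  apply: contrapT => allc; apply: uncountable_omega1.
  have -> : [set: omega1] = \bigcup_n [set a | f a = n].
    by apply/seteqP; split=> // a _; exists (f a).
  apply: bigcup_countable => // n _; apply: contrapT => nc.
  by apply: allc; exists n.
exists [set a | f a = n], (fun a => [set b | a < b /\ code b a = n]); split=> //.
- by move=> a <-; split; [exact: fP|move=> z []].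
- by move=> a b z [az an] [bz bn]; apply: (code_inj az bz); rewrite an.
Qed.

Lemma size_aleph1_sig (A : set omega1) :
  ~ countable A -> size_aleph1 [set: {a | `[< A a >]}].
Proof.
move=> Aunc; exists (fun a b => val a <= val b); split.
- apply: antisymmetric_wo_chain => [x y _ _|B _ [x Bx]].
    by move=> xy; apply: val_inj; apply: le_anti.
  have [|_ [y By <-] ymin] := @omega1_min (val @` [set x | x \in B]).
    by exists (val x); exists x.
  by exists y; split=> // z Bz; apply: ymin; exists z.
- by move=> /countable_sub.
- move=> a _.
  apply: (countable_preimage_inj (f := val) _ _ (countable_below (val a))).
    by move=> x y _ _; apply: val_inj.
  by move=> x [_ xa ne]; rewrite /= lt_neqAle xa andbT; apply/eqP => /val_inj.
Qed.

Section Agree.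
Variables (d : Order.disp_t) (S : set omega1).
Implicit Types x y : line d S.

Lemma agree_sym x y z : agree x y z -> agree y x z.
Proof. by move=> xy w wz; rewrite xy. Qed.

Lemma agree_ht_le x y z : agree x y z -> z <= ht x -> z <= ht y.
Proof.
move=> xy zx; rewrite leNgt; apply/negP => yz.
have /label0 xly : x (ht y) = 0%R by rewrite xy //; apply/label0.
by have := lt_le_trans (le_lt_trans xly yz) zx; rewrite ltxx.
Qed.

Lemma agree_convex x y t z : x <= y -> y <= t -> agree x t z -> agree x y z.
Proof.
move=> xy yt xt; have [->//|/eqP ne] := eqVneq x y.
have [w xyw xyw'] := first_difference ne.
case: (leP z w) => [zw|wz]; first by move=> v vz; apply: xyw; apply: lt_le_trans zw.
exfalso; case: (ltgtP (x w) (y w)) => [xltw|yx|//].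
  suff : t < y by rewrite ltNge yt.
  apply/line_ltP; exists w; last by rewrite -xt.
  by move=> v vw; rewrite -xt ?xyw // (lt_trans vw).
suff : y < x by rewrite ltNge xy.
by apply/line_ltP; exists w => // v vw; rewrite xyw.
Qed.

(** The first difference lies below [z], and as [z] is a limit there is room
    below it for the height of an interpolated point. *)
Lemma line_gap x y z : (forall w, w < z -> exists2 b, w < b & b < z) ->
  x < y -> ~ agree x y z -> exists c, [/\ ht c < z, x < c & c < y].
Proof.
move=> zlim /line_ltP[w xy xyw] nxy.
have wz : w < z.
  rewrite ltNge; apply/negP => zw; apply: nxy => v vz.
  by apply: xy; apply: lt_le_trans zw.
have [b wb bz] := zlim w wz.
by have [c [cb xc cy]] := line_between xy xyw wb; exists c; rewrite cb.
Qed.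

(** On [S] the end marker 0 is the least label, so the shortest point of a class
    is its least element. *)
Lemma node_least x y z : S z -> ht x = z -> agree x y z -> x <= y.
Proof.
move=> Sz xz xy; have [->//|/eqP ne] := eqVneq x y.
have [w xyw xyw'] := first_difference ne.
have x0 v : z <= v -> x v = 0%R by move=> zv; apply/label0; rewrite xz.
have zw : z <= w by rewrite leNgt; apply/negP => /xy.
have wz : w = z.
  apply: contrapT => /eqP wz; have {}zw : z < w by rewrite lt_neqAle eq_sym wz.
  apply: xyw'; rewrite x0 ?ltW //; apply/esym/label0.
  by apply: le_trans (ltW zw); apply/label0; rewrite -xyw // x0.
subst w; apply/ltW/line_ltP; exists z => //.
rewrite x0 // lt_neqAle label_ge0 // andbT; apply/eqP => y0; apply: xyw'.
by rewrite x0.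
Qed.

End Agree.

(** Choose [z] in [T], outside [S], closed under bounds for the heights of the
    images under [f] and of chosen preimages.  For a point [k] of height [z],
    let [v] be the truncation at [z] of a preimage of [k].  If [f v] and [k] were
    not equivalent, a point of small height would separate them, and its
    preimage would lie in the class of [v], which has no such points.  So [f v]
    is in the class of [k] and something smaller, [k'], is too.  A preimage of
    [k'] is below [v], hence outside its class, and a point of small height
    separates it from [v]; its image lies in the class of [k], which is absurd. *)
Lemma no_epi (d : Order.disp_t) (S T : set omega1) :
  stationary T -> (forall z, S z -> T z -> False) ->
  ~ epi_below (line d S : orderType d) (line d T : orderType d).
Proof.
move=> Tstat ST [E|[f [fmono fsurj]]].
  have [b _] := omega1_bound (countable0 omega1); have [x _] := exists_ht d S b.
  by have : [set: line d S] x by []; rewrite E.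
have {}fmono (x y : line d T) : x <= y -> f x <= f y := fmono x y.
have flt (x y : line d T) : f x < f y -> x < y.
  by move=> fxy; rewrite ltNge; apply/negP => /fmono; rewrite leNgt fxy.
have /choice [g gK] (a : line d S) : exists b : line d T, f b = a.
  by have [b _ fb] := fsurj a I; exists b.
have /choice [phi phiP] z : exists c : omega1, [/\ z < c,
    forall x : line d T, ht x = z -> ht (f x) < c &
    forall a : line d S, ht a = z -> ht (g a) < c].
  have [c1 zc1] := omega1_gt z.
  have [c2 c2P] := omega1_bound
    (sub_countable (card_image_le (fun x => ht (f x)) _) (@countable_level d T z)).
  have [c3 c3P] := omega1_bound
    (sub_countable (card_image_le (fun x => ht (g x)) _) (@countable_level d S z)).
  exists (Order.max c1 (Order.max c2 c3)); split.
  - by rewrite lt_max zc1.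
  - by move=> x xz; rewrite !lt_max c2P ?orbT //; exists x.
  - by move=> a az; rewrite !lt_max c3P ?orbT //; exists a.
(* [z] is a limit, and neither [f] nor its section [g] leaves the points of
   height below [z]. *)
have [z Tz zcl] := Tstat phi.
have nSz : ~ S z by move/ST; apply.
have zlim w : w < z -> exists2 b, w < b & b < z.
  by move=> wz; exists (phi w); [case: (phiP w)|apply: zcl].
have f_ht x : ht x < z -> ht (f x) < z.
  by move=> xz; have [_ h _] := phiP (ht x); apply: lt_trans (h _ erefl) (zcl _ xz).
have g_ht a : ht a < z -> ht (g a) < z.
  by move=> az; have [_ _ h] := phiP (ht a); apply: lt_trans (h _ erefl) (zcl _ az).
have g_ge a : z <= ht a -> z <= ht (g a).
  by move=> za; rewrite leNgt; apply/negP => /f_ht; rewrite gK ltNge za.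
(* [v] is the least point of its class in the line of [T]. *)
have [k kz] := exists_ht d S z.
have zb : z <= ht (g k) by apply: g_ge; rewrite kz.
pose v : line d T := mkline d (node_truncate (htP (g k)) zb).
have vz : ht v = z by apply: ht_mkline.
have vb : agree v (g k) z.
  by move=> w wz; rewrite /v /label /= /truncate wz.
have v_le_b : v <= g k := node_least Tz vz vb.
have fv_k : f v <= k by rewrite -(gK k); apply: fmono.
have fv_agree : agree (f v) k z.
  apply: contrapT => nagree.
  have fv_lt : f v < k.
    by rewrite lt_neqAle fv_k andbT; apply/eqP => E; apply: nagree; rewrite E.
  have [c [cz fvc ck]] := line_gap zlim fv_lt nagree.
  have vc : v < g c by apply: flt; rewrite gK.
  have cb : g c < g k by apply: flt; rewrite !gK.
  have := agree_ht_le (agree_convex (ltW vc) (ltW cb) vb); rewrite vz => /(_ (lexx _)).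
  by rewrite leNgt g_ht.
(* [k'] is a point of the class of [f v] below [f v]. *)
have z_fv : z <= ht (f v).
  by apply: agree_ht_le (agree_sym fv_agree) _; rewrite kz.
have [k' k'_agree k'_lt] := line_lower z_fv nSz.
have z_k' := agree_ht_le k'_agree z_fv.
have bv : g k' < v by apply: flt; rewrite gK.
have nagree : ~ agree (g k') v z.
  by move=> /agree_sym /(node_least Tz vz); rewrite leNgt bv.
have [c [cz bc cv]] := line_gap zlim bv nagree.
have k'_fc : k' <= f c by rewrite -(gK k'); apply: fmono; apply: ltW.
have fc_fv : f c <= f v by apply: fmono; apply: ltW.
have := agree_ht_le (agree_convex k'_fc fc_fv (agree_sym k'_agree)) z_k'.
by rewrite leNgt f_ht.
Qed.

Theorem corollary5p5 (d : Order.disp_t) :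
  exists (I : Type) (F : I -> orderType d),
    [/\ size_aleph1 [set: I],
        (forall i : I, aleph1_dense (F i) /\ countryman (F i)) &
        forall i j : I, i <> j ->
          ~ epi_below (F i) (F j) /\ ~ epi_below (F j) (F i)].
Proof.
have [A [S [Aunc Sstat Sdisj]]] := ulam_stationary.
pose I := {a | `[< A a >]}.
have AI (i : I) : A (val i) by apply/asboolP/(valP i).
exists I, (fun i => line d (S (val i)) : orderType d); split.
- exact: size_aleph1_sig.
- move=> i; split; last exact: countryman_line.
  by apply: aleph1_dense_line => z Sz; exists (val i); apply: (Sstat _ (AI i)).2.
- have anti (i j : I) : i <> j -> ~ epi_below
      (line d (S (val i)) : orderType d) (line d (S (val j)) : orderType d).
    move=> ij; apply: no_epi => [|z zi zj]; first exact: (Sstat _ (AI j)).1.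
    by apply: ij; apply: val_inj; apply: Sdisj zi zj.
  by move=> i j ij; split; apply: anti => // ji; apply: ij.
Qed.
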